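(* Let $X\subseteq\mathbb{R}^m$, $Y\subseteq\mathbb{R}^n$ be nonempty, compact, convex sets, $A$ and $B$ real matrices of sizes $q\times n$ and $q\times m$, $b\in\mathbb{R}^q$, and for $x\in X$ let $S(x)=\{y\in Y: Ay+Bx=b,\ g(y,x)\le0\}$ and $\mathcal{Q}(x)=\inf\{f(y,x): y\in S(x)\}$, where $g=(g_1,\ldots,g_p)$. Take $\bar x\in X$ such that $S(\bar x)\neq\emptyset$. Assume that $f:\mathbb{R}^n\times\mathbb{R}^m\to\mathbb{R}\cup\{+\infty\}$ is lower semicontinuous, proper, and convex, that each $g_i:\mathbb{R}^n\times\mathbb{R}^m\to\mathbb{R}\cup\{+\infty\}$ is convex and lower semicontinuous, and that the following constraint qualification holds: there exists $y_0\in\mathrm{ri}(Y)\cap\mathrm{ri}(\{g(\cdot,\bar x)\le0\})$ such that $Ay_0+B\bar x=b$. Assume that $f$ and $g$ are differentiable on $Y\times X$. Let $(\bar\lambda,\bar\mu)$ be an optimal solution of the dual problem $$\sup_{(\lambda,\mu)\in\mathbb{R}^q\times\mathbb{R}^p_+}\theta_{\bar x}(\lambda,\mu),\qquad\theta_{\bar x}(\lambda,\mu)=\inf_{y\in Y}\{f(y,\bar x)+\lambda^T(Ay+B\bar x-b)+\mu^Tg(y,\bar x)\},$$ and let $$s(\bar x)=\nabla_xf(\bar y,\bar x)+B^T\bar\lambda+\sum_{i\in I(\bar y,\bar x)}\bar\mu_i\nabla_xg_i(\bar y,\bar x),$$ where $\bar y$ is any element of the solution set $\{y\in S(\bar x):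 f(y,\bar x)=\mathcal{Q}(\bar x)\}$ and $I(\bar y,\bar x)=\{i\in\{1,\ldots,p\}: g_i(\bar y,\bar x)=0\}$. Then $s(\bar x)\in\partial\mathcal{Q}(\bar x)$.
   Context: $\mathrm{ri}$ denotes relative interior. $\mathcal{Q}$ is a function $X\to\mathbb{R}\cup\{+\infty\}$, and $s\in\partial\mathcal{Q}(\bar x)$ means $\mathcal{Q}(x)\ge\mathcal{Q}(\bar x)+\langle s,x-\bar x\rangle$ for all $x\in X$. *)

(* Defs.v *)
From HB Require Import structures.
From mathcomp Require Import all_boot all_order all_algebra.
From mathcomp Require Import all_classical all_reals all_analysis.

Set Implicit Arguments.
Unset Strict Implicit.
Unset Printing Implicit Defensive.

Import Order.TTheory GRing.Theory Num.Theory.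
Import numFieldNormedType.Exports.

Local Open Scope classical_set_scope.
Local Open Scope ring_scope.

Definition dotcv (R : realType) (k : nat) (u v : 'cV[R]_k) : R :=
  (u^T *m v) 0 0.

(* Functions with values in R U {+oo} are encoded as functions into \bar R
   that never take the value -oo. *)
Definition not_ninfty (R : realType) (T : Type) (f : T -> \bar R) : Prop :=
  forall z, f z <> -oo%E.

Definition proper_fun (R : realType) (T : Type) (f : T -> \bar R) : Prop :=
  not_ninfty f /\ exists z, (f z < +oo)%E.

Definition convex_efun (R : realType) (E : lmodType R) (f : E -> \bar R) :
    Prop :=
  forall (u v : E) (t : R), 0 < t -> t < 1 ->
    (f (t *: u + (1 - t) *: v)%R <= t%:E * f u + (1 - t)%:E * f v)%E.

(* As fine +oo = 0, differentiability of fine \o f is only meaningful at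
   points around which f is finite. *)
Definition edifferentiable (R : realType) (E : normedModType R)
    (f : E -> \bar R) (z : E) : Prop :=
  (\forall w \near z, f w \is a fin_num) /\ differentiable (fine \o f) z.

Definition gradx (R : realType) (n m : nat)
    (f : 'cV[R]_n * 'cV[R]_m -> \bar R) (y : 'cV[R]_n) (x : 'cV[R]_m) :
    'cV[R]_m :=
  \col_j 'D_(delta_mx j 0 : 'cV[R]_m) (fun x' => fine (f (y, x'))) x.

Definition affine_set (R : realType) (E : lmodType R) (M : set E) : Prop :=
  forall (u v : E) (t : R), M u -> M v -> M (t *: u + (1 - t) *: v).

Definition affine_hull (R : realType) (E : lmodType R) (C : set E) : set E :=
  \bigcap_(M in [set M | affine_set M /\ C `<=` M]) M.

Definition relative_interior (R : realType) (E : normedModType R)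
    (C : set E) : set E :=
  [set u | affine_hull C u /\ \forall v \near u, affine_hull C v -> C v].

Definition subdifferential (R : realType) (m : nat) (X : set 'cV[R]_m)
    (Q : 'cV[R]_m -> \bar R) (xbar : 'cV[R]_m) : set 'cV[R]_m :=
  [set s | forall x, X x -> (Q xbar + (dotcv s (x - xbar)%R)%:E <= Q x)%E].

Section parametric_program.
Context {R : realType} {n m p q : nat}.
Variables (Y : set 'cV[R]_n) (A : 'M[R]_(q, n)) (B : 'M[R]_(q, m)).
Variables (b : 'cV[R]_q).
Variables (f : 'cV[R]_n * 'cV[R]_m -> \bar R).
Variables (g : 'I_p -> 'cV[R]_n * 'cV[R]_m -> \bar R).

Definition constraint_set (x : 'cV[R]_m) : set 'cV[R]_n :=
  [set y | forall i, (g i (y, x) <= 0)%E].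

Definition feasible_set (x : 'cV[R]_m) : set 'cV[R]_n :=
  [set y | [/\ Y y, A *m y + B *m x = b & constraint_set x y]].

Definition value_fun (x : 'cV[R]_m) : \bar R :=
  ereal_inf [set f (y, x) | y in feasible_set x].

Definition solution_set (x : 'cV[R]_m) : set 'cV[R]_n :=
  [set y | feasible_set x y /\ f (y, x) = value_fun x].

Definition lagrangian (x : 'cV[R]_m) (lam : 'cV[R]_q) (mu : 'cV[R]_p)
    (y : 'cV[R]_n) : \bar R :=
  (f (y, x) + (dotcv lam (A *m y + B *m x - b)%R)%:E
   + \sum_(i < p) (mu i 0)%:E * g i (y, x))%E.

Definition dual_fun (x : 'cV[R]_m) (lam : 'cV[R]_q) (mu : 'cV[R]_p) : \bar R :=
  ereal_inf [set lagrangian x lam mu y | y in Y].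

Definition nonneg_cv (mu : 'cV[R]_p) : Prop := forall i, 0 <= mu i 0.

Definition dual_optimal (x : 'cV[R]_m) (lam : 'cV[R]_q) (mu : 'cV[R]_p) :
    Prop :=
  nonneg_cv mu /\
  forall lam' mu', nonneg_cv mu' ->
    (dual_fun x lam' mu' <= dual_fun x lam mu)%E.

End parametric_program.

(* Main.v *)
Require Import Defs.
From HB Require Import structures.
From mathcomp Require Import all_boot all_order all_algebra.
From mathcomp Require Import all_classical all_reals all_analysis.
From mathcomp Require Import ring lra.
Import Order.TTheory GRing.Theory Num.Theory.
Import numFieldNormedType.Exports.
Local Open Scope classical_set_scope.
Local Open Scope ring_scope.

(** The slope formula comes from the linearisation at (ybar, xbar) of the
    Lagrangian regarded as a function of the pair (y, x), once it is known
    that the optimal multipliers make ybar a minimiser of the Lagrangian over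
    Y.

    That second fact rests on the absence of a duality gap, which compactness
    of Y provides ([compact_strong_duality]).  Given al below the optimal
    value, the convex inequalities f - al <= 0, g_i <= 0 and the two halves
    of A y + B x = b have no common solution in Y, so by a theorem of the
    alternative ([convex_alternative]) some nonnegative combination of them
    is positive on all of Y.  As the problem is feasible, f - al carries a
    positive weight there, and dividing by it yields multipliers of dual value
    at least al ([exists_multipliers]).  The alternative itself is a least
    squares argument: minimise over Y the sum of the squared positive parts of
    the constraint functions, and use these positive parts at the minimiser
    as weights.

    Dual optimality therefore gives f(ybar, xbar) <= L(y) for every y in Y,
    where L is the Lagrangian at xbar.  At y = ybar this forces
    complementary slackness mubar_i g_i(ybar, xbar) = 0, so that ybar
    minimises L over Y, and the gradient sum may be restricted to the active
    constraints.

    Put H = f + sum_i mubar_i g_i.  Minimality of ybar gives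
    dH(y - ybar, 0) >= - <lambar, A (y - ybar)> for y in Y, and convexity
    gives H(y, x) >= H(ybar, xbar) + dH(y - ybar, x - xbar).  If y is feasible
    for x then A (y - ybar) = - B (x - xbar) and f(y, x) >= H(y, x); adding
    up, f(y, x) >= Q(xbar) + <lambar, B (x - xbar)> + dH(0, x - xbar), whose
    linear part is <s(xbar), x - xbar>.  The infimum over y concludes. *)

(** * The inner product of column vectors *)

Lemma dotcvE {R : realType} (k : nat) (u v : 'cV[R]_k) :
  dotcv u v = \sum_i u i 0 * v i 0.
Proof. by rewrite /dotcv mxE; apply: eq_bigr => i _; rewrite mxE. Qed.

Lemma dotcvZr {R : realType} (k : nat) (u v : 'cV[R]_k) (t : R) :
  dotcv u (t *: v) = t * dotcv u v.
Proof. by rewrite /dotcv -scalemxAr mxE. Qed.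

Lemma dotcvDl {R : realType} (k : nat) (u v w : 'cV[R]_k) :
  dotcv (u + v) w = dotcv u w + dotcv v w.
Proof. by rewrite /dotcv linearD mulmxDl mxE. Qed.

Lemma dotcvZl {R : realType} (k : nat) (u v : 'cV[R]_k) (t : R) :
  dotcv (t *: u) v = t * dotcv u v.
Proof. by rewrite /dotcv linearZ -scalemxAl mxE. Qed.

Lemma dotcv_suml {R : realType} (k : nat) (I : finType) (P : pred I)
    (u : I -> 'cV[R]_k) (v : 'cV[R]_k) :
  dotcv (\sum_(i | P i) u i) v = \sum_(i | P i) dotcv (u i) v.
Proof. by rewrite /dotcv raddf_sum mulmx_suml summxE. Qed.

Lemma dotcv_trmulmx {R : realType} (k l : nat) (B : 'M[R]_(k, l))
    (u : 'cV[R]_k) (v : 'cV[R]_l) : dotcv (B^T *m u) v = dotcv u (B *m v).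
Proof. by rewrite /dotcv trmx_mul trmxK mulmxA. Qed.

(** * Real-valued versions of the data *)

Lemma convex_efun_fine {R : realType} {E : lmodType R} {f : E -> \bar R} {u v : E}
    {t : R} :
  not_ninfty f -> convex_efun f -> f u \is a fin_num -> f v \is a fin_num ->
  0 < t -> t < 1 ->
  fine (f (t *: u + (1 - t) *: v)) <= t * fine (f u) + (1 - t) * fine (f v).
Proof.
move=> fN fc fu fv t0 t1; have := fc u v t t0 t1.
rewrite -(fineK fu) -(fineK fv) -!EFinM -EFinD.
by case: (f _) (fN (t *: u + (1 - t) *: v)) => [r _| _|] //; rewrite ?lee_fin.
Qed.

Lemma edifferentiable_fin_num {R : realType} {E : normedModType R}
    {f : E -> \bar R} {z : E} : edifferentiable f z -> f z \is a fin_num.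
Proof. by case=> /nbhs_singleton. Qed.

Lemma continuous_partial {R : realType} {U V : normedModType R} (F : U * V -> R)
    (Y : set U) (x : V) :
  (forall y, Y y -> differentiable F (y, x)) ->
  {within Y, continuous (fun y => F (y, x))}.
Proof.
move=> dF; apply: continuous_in_subspaceT => y; rewrite inE => Yy.
apply: (@continuous_comp _ _ _ (fun y => (y, x)) F).
  by apply: cvg_pair; [exact: cvg_id|exact: cvg_cst].
exact: differentiable_continuous (dF y Yy).
Qed.

Lemma lagrangian_fine {R : realType} {n m p q : nat}
    (A : 'M[R]_(q, n)) (B : 'M[R]_(q, m)) (b : 'cV[R]_q)
    (f : 'cV[R]_n * 'cV[R]_m -> \bar R)
    (g : 'I_p -> 'cV[R]_n * 'cV[R]_m -> \bar R)
    (x : 'cV[R]_m) (lam : 'cV[R]_q) (mu : 'cV[R]_p) (y : 'cV[R]_n) :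
  f (y, x) \is a fin_num -> (forall i, g i (y, x) \is a fin_num) ->
  lagrangian A B b f g x lam mu y =
    (fine (f (y, x)) + dotcv lam (A *m y + B *m x - b)
     + \sum_i mu i 0 * fine (g i (y, x)))%:E.
Proof.
move=> fy gy; rewrite /lagrangian !EFinD fineK // -sumEFin.
by congr (_ + _)%E; apply: eq_bigr => i _; rewrite EFinM fineK.
Qed.

(** * A theorem of the alternative for convex functions *)

Definition convex_on {R : realType} {E : lmodType R} (D : set E) (F : E -> R) :=
  forall u v t, D u -> D v -> 0 < t -> t < 1 ->
    F (t *: u + (1 - t) *: v) <= t * F u + (1 - t) * F v.

Lemma convex_set_comb {R : realType} {E : lmodType R} {D : set E} : convex_set D ->
  forall (u v : E) (t : R), D u -> D v -> 0 < t -> t < 1 ->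
    D (t *: u + (1 - t) *: v).
Proof.
move=> cD u v t Du Dv t0 t1.
have := cD u v (Itv01 (ltW t0) (ltW t1)).
by rewrite !inE => /(_ Du Dv).
Qed.

Lemma sum_sqr_pos_part_continuous {R : realType} {T : topologicalType}
    {K : finType} {a : K -> T -> R} :
  (forall k, continuous (a k)) ->
  continuous (fun y => \sum_k (Num.max 0 (a k y)) ^+ 2).
Proof.
move=> ca y.
apply: (@cvg_big R K +%R 0 xpredT) => //.
  exact: add_continuous.
move=> k _.
have h : {for y, continuous (fun y => Num.max 0 (a k y))}.
  apply: continuous_max; [exact: cst_continuous|exact: ca].
exact: (cvgM h h).
Qed.

(** Along a segment the increment [d] is proportional to the time parameter,
    so this bounds the squared positive part by a quadratic polynomial in time
    which is exact at the start.  Comparing with that polynomial yields the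
    first order condition at a minimum without any differentiation. *)
Lemma sqr_pos_part_step {R : realType} (x d e : R) :
  e <= x + d -> (Num.max 0 e) ^+ 2 <= (Num.max 0 x + d) ^+ 2.
Proof.
move=> exd.
case: (leP 0 x) => x0; case: (leP 0 e) => e0; rewrite ?expr0n /= ?sqr_ge0 //;
  rewrite ler_sqr ?nnegrE; lra.
Qed.

(** The weights are the positive parts [w k] of the functions at a minimiser
    [c] over [Y] of the sum of their squares.  Moving from [c] towards [y]
    cannot decrease that sum, so to first order the weighted sum at [y] is at
    least the one at [c], which equals [\sum_k w k ^+ 2] and is positive
    because some function is positive at [c]. *)
Lemma convex_alternative {R : realType} (E : normedModType R) (K : finType)
    (Y : set E) (a : K -> E -> R) :
  Y !=set0 -> compact Y -> convex_set Y ->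
  (forall k, {within Y, continuous (a k)}) -> (forall k, convex_on Y (a k)) ->
  (forall y, Y y -> exists k, 0 < a k y) ->
  exists w : K -> R, (forall k, 0 <= w k) /\
    forall y, Y y -> 0 < \sum_k w k * a k y.
Proof.
move=> Y0 Yc cY ca cva apos.
have [c cYc cmin] := compact_EVT_min Y0 Yc
  (sum_sqr_pos_part_continuous (T := subspace Y) ca).
rewrite inE in cYc.
pose w k := Num.max 0 (a k c).
have w0 k : 0 <= w k by rewrite /w le_max lexx.
exists w; split=> // y Yy.
have wa k : w k * a k c = w k ^+ 2.
  by rewrite /w; case: (leP 0 (a k c)) => _; rewrite ?mul0r ?expr0n //= expr2.
have ww : 0 < \sum_k w k ^+ 2.
  have [k ak] := apos _ cYc.
  rewrite (bigD1 k) //= ltr_pwDl ?sumr_ge0// => [|i _]; last exact: sqr_ge0.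
  by rewrite exprn_gt0 // /w lt_max ak orbT.
pose d k := a k y - a k c.
pose D := \sum_k w k * d k; pose N := \sum_k d k ^+ 2.
(* The objective at the point c + t (y - c) is at most its value at c plus
   t * (2 * D + t * N). *)
have step t : 0 < t -> t < 1 -> 0 <= 2 * D + t * N.
  move=> t0 t1.
  have Yt : Y (t *: y + (1 - t) *: c) by exact: convex_set_comb.
  have := cmin _ (mem_set Yt).
  have le2 : \sum_k Num.max 0 (a k (t *: y + (1 - t) *: c)) ^+ 2 <=
     \sum_k (w k + t * d k) ^+ 2.
    apply: ler_sum => k _; apply: sqr_pos_part_step.
    by apply: (le_trans (cva k y c t Yy cYc t0 t1)); rewrite /d; lra.
  move=> /le_trans /(_ le2).
  rewrite (_ : \sum_k (w k + t * d k) ^+ 2 =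
     \sum_k w k ^+ 2 + t * (2 * D + t * N)); last first.
    rewrite /D /N mulrDr !mulr_sumr -!big_split /=.
    by apply: eq_bigr => k _; ring.
  by rewrite lerDl pmulr_rge0.
have N0 : 0 <= N by apply: sumr_ge0 => k _; exact: sqr_ge0.
have D0 : 0 <= D.
  rewrite leNgt; apply/negP => Dlt.
  (* small enough that t * N <= - D, and less than 1 *)
  pose t := - D / (N + 1 - D).
  have den : 0 < N + 1 - D by lra.
  have t0 : 0 < t by rewrite divr_gt0 //; lra.
  have t1 : t < 1 by rewrite ltr_pdivrMr //; lra.
  have tN : t * N <= - D.
    rewrite mulrAC ler_pdivrMr // ler_wpM2l //; lra.
  have := step t t0 t1; lra.
rewrite (_ : \sum_k _ = D + \sum_k w k ^+ 2); last first.
  rewrite -big_split /=; apply: eq_bigr => k _; rewrite -wa /d; ring.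
by rewrite ltr_wpDl.
Qed.

(** * Strong duality over a compact set *)

(** Each equation [h j = 0] enters the alternative as the pair [h j <= 0],
    [- h j <= 0], and the difference of its two weights is a multiplier of
    free sign.  The weight [rho] of [F - al] is positive: otherwise the
    combination would be nonpositive at a feasible point. *)
Lemma exists_multipliers {R : realType} (E : normedModType R) (p q : nat)
    (Y : set E) (F : E -> R) (h : 'I_q -> E -> R) (G : 'I_p -> E -> R) (al : R) :
  compact Y -> convex_set Y ->
  {within Y, continuous F} -> convex_on Y F ->
  (forall j, {within Y, continuous (h j)}) ->
  (forall j u v t, h j (t *: u + (1 - t) *: v) = t * h j u + (1 - t) * h j v) ->
  (forall i, {within Y, continuous (G i)}) -> (forall i, convex_on Y (G i)) ->
  (exists y, [/\ Y y, forall j, h j y = 0 & forall i, G i y <= 0]) ->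
  (forall y, Y y -> (forall j, h j y = 0) -> (forall i, G i y <= 0) -> al < F y) ->
  exists (lam : 'I_q -> R) (mu : 'I_p -> R), (forall i, 0 <= mu i) /\
    forall y, Y y ->
      al <= F y + \sum_j lam j * h j y + \sum_i mu i * G i y.
Proof.
move=> Yc cY Fc cF hc ha Gc cG [y1 [Yy1 h1 G1]] Fal.
pose a (k : unit + ('I_q + 'I_q) + 'I_p) : E -> R := match k with
  | inl (inl _) => fun y => F y - al
  | inl (inr (inl j)) => h j
  | inl (inr (inr j)) => fun y => - h j y
  | inr i => G i
  end.
have [||||w [w0 wpos]] := @convex_alternative R E _ Y a _ Yc cY.
- by exists y1.
- move=> [[[]|[j|j]]|i] //= y.
  + apply: cvgB; [exact: Fc|exact: cvg_cst].
  + by apply: cvgN; exact: hc.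
- move=> [[[]|[j|j]]|i] u v t Yu Yv t0 t1 /=.
  + by have := cF u v t Yu Yv t0 t1; lra.
  + by rewrite ha.
  + by rewrite ha; lra.
  + exact: cG.
- move=> y Yy; apply/not_existsP => npos.
  have np k : a k y <= 0 by rewrite leNgt; apply/negP; exact: npos.
  have hy j : h j y = 0.
    by apply/le_anti; rewrite (np (inl (inr (inl j)))) -oppr_le0 (np (inl (inr (inr j)))).
  have := Fal y Yy hy (fun i => np (inr i)).
  by have := np (inl (inl tt)); rewrite /=; lra.
pose rho := w (inl (inl tt)).
have wE y : \sum_k w k * a k y = rho * (F y - al)
   + \sum_j (w (inl (inr (inl j))) - w (inl (inr (inr j)))) * h j y
   + \sum_i w (inr i) * G i y.
  rewrite !big_sumType /= (big_pred1 tt) /=; last by case.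
  rewrite -big_split /=; congr (_ + _ + _).
  by apply: eq_bigr => j _; ring.
have rho0 : 0 < rho.
  rewrite lt_neqAle w0 andbT; apply/negP => /eqP rho0.
  have := wpos _ Yy1; rewrite wE -rho0 mul0r add0r big1 ?add0r => [|j _]; last first.
    by rewrite h1 mulr0.
  apply/negP; rewrite -leNgt; apply: sumr_le0 => i _.
  exact: mulr_ge0_le0.
exists (fun j => (w (inl (inr (inl j))) - w (inl (inr (inr j)))) / rho).
exists (fun i => w (inr i) / rho); split=> [i|y Yy].
  by rewrite divr_ge0 // ltW.
have := wpos _ Yy; rewrite wE.
rewrite -(pmulr_rgt0 _ (_ : 0 < rho^-1)) ?invr_gt0 // !mulrDr !mulr_sumr.
rewrite mulrA mulVf ?gt_eqF // mul1r.
under eq_bigr do rewrite mulrA (mulrC rho^-1).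
under [X in _ + X]eq_bigr do rewrite mulrA (mulrC rho^-1).
rewrite mulrN mulrN mulKf ?gt_eqF //; lra.
Qed.

Lemma affine_comb {R : realType} {n m q : nat}
    (A : 'M[R]_(q, n)) (c : 'cV[R]_q) (u v : 'cV[R]_n) (t : R) j :
  (A *m (t *: u + (1 - t) *: v) + c) j 0 =
  t * (A *m u + c) j 0 + (1 - t) * (A *m v + c) j 0.
Proof. by rewrite mulmxDr -!scalemxAr !mxE; ring. Qed.

Lemma affine_continuous {R : realType} {n q : nat} (A : 'M[R]_(q, n))
    (c : 'cV[R]_q) j :
  continuous (fun y : 'cV[R]_n => (A *m y + c) j 0).
Proof.
have -> : (fun y : 'cV[R]_n => (A *m y + c) j 0) =
          (fun y => \sum_k A j k * y k 0 + c j 0).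
  by apply/funext => y; rewrite !mxE.
(* Stated for an abstract space because, for column vectors, unification
   unfolds the neighbourhood filter to its entrywise definition. *)
have comb (T : topologicalType) (u : 'I_n -> T -> R) :
    (forall k, continuous (u k)) ->
    continuous (fun y => \sum_k A j k * u k y + c j 0).
  move=> cu y; apply: cvgD; last exact: cvg_cst.
  apply: (@cvg_big R 'I_n +%R 0 xpredT) => //; first exact: add_continuous.
  by move=> k _; apply: cvgM; [exact: cvg_cst|exact: cu].
by apply: (comb _ (fun k (y : 'cV[R]_n) => y k 0)) => k; exact: coord_continuous.
Qed.

(** The convex program over a compact set has approximate multipliers at every
    level [v - e] below its value [v], so the best dual value reaches [v]. *)
Lemma compact_strong_duality {R : realType} {n m p q : nat}
    {Y : set 'cV[R]_n} {A : 'M[R]_(q, n)} {B : 'M[R]_(q, m)} {b : 'cV[R]_q}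
    {f : 'cV[R]_n * 'cV[R]_m -> \bar R}
    {g : 'I_p -> 'cV[R]_n * 'cV[R]_m -> \bar R}
    {x : 'cV[R]_m} {lam : 'cV[R]_q} {mu : 'cV[R]_p} :
  compact Y -> convex_set Y ->
  not_ninfty f -> convex_efun f ->
  (forall i, not_ninfty (g i)) -> (forall i, convex_efun (g i)) ->
  (forall y, Y y -> edifferentiable f (y, x)) ->
  (forall i y, Y y -> edifferentiable (g i) (y, x)) ->
  solution_set Y A B b f g x !=set0 ->
  dual_optimal Y A B b f g x lam mu ->
  (value_fun Y A B b f g x <= dual_fun Y A B b f g x lam mu)%E.
Proof.
move=> Yc cY fN fc gN gc df dg [y0 [[Yy0 Ay0 gy0] fy0]] [_ opt].
have ff y : Y y -> f (y, x) \is a fin_num by move=> /df /edifferentiable_fin_num.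
have gf i y : Y y -> g i (y, x) \is a fin_num.
  by move=> /(dg i) /edifferentiable_fin_num.
have xcomb (u v : 'cV[R]_n) t :
    (t *: u + (1 - t) *: v, x) = t *: (u, x) + (1 - t) *: (v, x).
  by rewrite [RHS]surjective_pairing /= -scalerDl (addrC t) subrK scale1r.
have vN : value_fun Y A B b f g x \is a fin_num by rewrite -fy0 ff.
apply/lee_subgt0Pr => e e0.
pose al := fine (value_fun Y A B b f g x) - e.
have -> : (value_fun Y A B b f g x - e%:E)%E = al%:E by rewrite EFinB fineK.
have [||||||||lam' [mu' [mu'0 le_al]]] := @exists_multipliers R _ p q Y
  (fun y => fine (f (y, x))) (fun j y => (A *m y + (B *m x - b)) j 0)
  (fun i y => fine (g i (y, x))) al Yc cY.
- by apply: (@continuous_partial _ _ _ (fine \o f)) => y /df [].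
- by move=> u v t /ff fu /ff fv t0 t1; rewrite xcomb; exact: convex_efun_fine.
- move=> j; apply: continuous_subspaceT; exact: affine_continuous.
- by move=> j u v t; exact: affine_comb.
- by move=> i; apply: (@continuous_partial _ _ _ (fine \o g i)) => y /(dg i) [].
- move=> i u v t /(gf i) fu /(gf i) fv t0 t1.
  by rewrite xcomb; exact: convex_efun_fine.
- exists y0; split=> // [j|i]; first by rewrite addrA Ay0 subrr mxE.
  by rewrite -lee_fin fineK ?gf.
- move=> y Yy hy gy; have : feasible_set Y A B b g x y.
    split=> // [|i]; last by rewrite -(fineK (gf i y Yy)) lee_fin.
    apply/eqP; rewrite -subr_eq0 -addrA; apply/eqP/matrixP => j k.
    by rewrite ord1 hy mxE.
  move=> Sy; rewrite ltrBlDr; apply: (@le_lt_trans _ _ (fine (f (y, x)))).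
    by rewrite fine_le // ?ff //; apply: ereal_inf_lbound; exists y.
  by rewrite ltrDl.
have mu'pos : nonneg_cv (\col_i mu' i) by move=> i; rewrite mxE.
apply: (le_trans _ (opt (\col_j lam' j) _ mu'pos)).
apply: le_ereal_inf_tmp => _ [y Yy <-].
rewrite lagrangian_fine ?ff ?gf // => [|i]; last exact: gf.
rewrite lee_fin dotcvE; apply: (le_trans (le_al y Yy)).
rewrite le_eqVlt; apply/orP; left; apply/eqP; congr (_ + _ + _).
  by apply: eq_bigr => j _; rewrite addrA; congr (_ * _); rewrite mxE.
by apply: eq_bigr => i _; rewrite mxE.
Qed.

(** * Differentials and partial gradients *)

(** One statement serves both for the gradient inequality of a convex
    function and, applied to [- F], for the first order condition at a minimum
    over a convex set. *)
Lemma diff_le_slope {R : realType} (V : normedModType R) (F : V -> R) (z h : V)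
    (c : R) :
  differentiable F z ->
  (forall t, 0 < t -> t < 1 -> F (z + t *: h) - F z <= t * c) ->
  'd F z h <= c.
Proof.
move=> dF Fle; rewrite -deriveE //.
have cF : derivable F z h by exact: diff_derivable.
rewrite /derive cvg_at_rightE //; apply: limr_le.
  by apply/cvg_ex; case/cvg_ex: cF => l /cvg_dnbhs_at_right Fl; exists l.
near=> t.
have t0 : 0 < t by near: t; exact: nbhs_right_gt.
have t1 : t < 1 by near: t; exact: nbhs_right_lt.
rewrite /= -[_ *: _]/(_ * _) mulrC ler_pdivrMr // addrC [c * t]mulrC.
by rewrite addrC [_ *: _ + _]addrC Fle.
Unshelve. all: by end_near. Qed.

Lemma dotcv_gradx {R : realType} (n m : nat)
    (f : 'cV[R]_n * 'cV[R]_m -> \bar R) (y : 'cV[R]_n) (x h : 'cV[R]_m) :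
  differentiable (fine \o f) (y, x) ->
  dotcv (gradx f y x) h = 'd (fine \o f) (y, x) (0, h).
Proof.
move=> df.
have -> : (0 : 'cV[R]_n, h) = \sum_j h j 0 *: (0, delta_mx j 0).
  rewrite [RHS]surjective_pairing !raddf_sum /=; congr pair.
    by rewrite big1 // => j _; rewrite scaler0.
  by rewrite [LHS]matrix_sum_delta; apply: eq_bigr => j _; rewrite big_ord1.
rewrite dotcvE linear_sum; apply: eq_bigr => j _.
rewrite linearZ mulrC -deriveE // mxE; congr (_ * _).
(* The difference quotients of the partial function and of the function of the
   pair in direction (0, delta_mx j 0) coincide. *)
have stepE t : t *: (0, delta_mx j 0) + (y, x) = (y, t *: delta_mx j 0 + x).
  by rewrite [LHS]surjective_pairing /= scaler0 add0r.
by rewrite /derive /shift /=; under [in RHS]eq_fun do rewrite stepE.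
Qed.

Lemma sum_smul_diff {R : realType} {V : normedModType R} (p : nat)
  (F : V -> R) (G : 'I_p -> V -> R) (mu : 'I_p -> R) (z h : V) :
  differentiable F z -> (forall i, differentiable (G i) z) ->
  differentiable (F + \sum_i mu i *: G i) z /\
  'd (F + \sum_i mu i *: G i) z h = 'd F z h + \sum_i mu i * 'd (G i) z h.
Proof.
move=> dF dG.
have dmG i : differentiable (mu i *: G i) z by exact: differentiableZ.
have ds : differentiable (\sum_i mu i *: G i) z by exact: differentiable_sum.
split; first exact: differentiableD.
rewrite diffD //=; congr (_ + _).
rewrite -deriveE // derive_sum => [|i]; last exact: diff_derivable.
by apply: eq_bigr => i _; rewrite deriveE // diffZ.
Qed.

(** * The subgradient of the value function *)

Theorem proposition3p2 (R : realType) (n m p q : nat)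
  (X : set 'cV[R]_m) (Y : set 'cV[R]_n)
  (X_neq0 : X !=set0) (X_compact : compact X) (X_convex : convex_set X)
  (Y_neq0 : Y !=set0) (Y_compact : compact Y) (Y_convex : convex_set Y)
  (A : 'M[R]_(q, n)) (B : 'M[R]_(q, m)) (b : 'cV[R]_q)
  (f : 'cV[R]_n * 'cV[R]_m -> \bar R)
  (g : 'I_p -> 'cV[R]_n * 'cV[R]_m -> \bar R)
  (xbar : 'cV[R]_m) (xbarX : X xbar)
  (S_neq0 : feasible_set Y A B b g xbar !=set0)
  (f_lsc : lower_semicontinuous f) (f_proper : proper_fun f)
  (f_convex : convex_efun f)
  (g_not_ninfty : forall i, not_ninfty (g i))
  (g_convex : forall i, convex_efun (g i))
  (g_lsc : forall i, lower_semicontinuous (g i))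
  (constraint_qualification : exists y0 : 'cV[R]_n,
     (relative_interior Y `&` relative_interior (constraint_set g xbar)) y0
     /\ A *m y0 + B *m xbar = b)
  (f_diff : forall z, (Y `*` X) z -> edifferentiable f z)
  (g_diff : forall i z, (Y `*` X) z -> edifferentiable (g i) z)
  (lambar : 'cV[R]_q) (mubar : 'cV[R]_p)
  (dual_opt : dual_optimal Y A B b f g xbar lambar mubar)
  (ybar : 'cV[R]_n) (ybar_sol : solution_set Y A B b f g xbar ybar) :
  subdifferential X (value_fun Y A B b f g) xbar
    (gradx f ybar xbar + B^T *m lambar
     + \sum_(i < p | g i (ybar, xbar) == 0%E)
         mubar i 0 *: gradx (g i) ybar xbar).
Proof.
have [fN _] := f_proper.
have [[Ybar Abar gbar] fbar] := ybar_sol.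
have mu0 : nonneg_cv mubar by case: dual_opt.
have ff y x : Y y -> X x -> f (y, x) \is a fin_num.
  by move=> Yy Xx; apply: edifferentiable_fin_num; apply: f_diff.
have gf i y x : Y y -> X x -> g i (y, x) \is a fin_num.
  by move=> Yy Xx; apply: edifferentiable_fin_num; apply: g_diff.
have fbarF := ff _ _ Ybar xbarX.
pose F := fine \o f; pose G i := fine \o g i.
pose L y := F (y, xbar) + dotcv lambar (A *m y + B *m xbar - b)
     + \sum_i mubar i 0 * G i (y, xbar).
(* By strong duality the left-hand side is at most the infimum of L over Y. *)
have saddle y : Y y -> F (ybar, xbar) <= L y.
  move=> Yy; rewrite -lee_fin fineK //.
  rewrite -lagrangian_fine; [|exact: ff|by move=> i; exact: gf].
  rewrite fbar; apply: (le_trans (compact_strong_duality (x := xbar)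
    Y_compact Y_convex fN f_convex g_not_ninfty g_convex _ _ _ dual_opt)).
  - by move=> z Yz; exact: f_diff.
  - by move=> i z Yz; exact: g_diff.
  - by exists ybar.
  by apply: ereal_inf_lbound; exists y.
have dotcv0 : dotcv lambar (A *m ybar + B *m xbar - b) = 0.
  by rewrite Abar subrr /dotcv mulmx0 mxE.
have Gle0 i : G i (ybar, xbar) <= 0 by rewrite -lee_fin fineK ?gbar //; exact: gf.
(* The terms are nonpositive, and their sum is nonnegative by saddle at ybar. *)
have slack i : mubar i 0 * G i (ybar, xbar) = 0.
  have le0 k : true -> mubar k 0 * G k (ybar, xbar) <= 0.
    by move=> _; exact: mulr_ge0_le0.
  have /eqP : \sum_k mubar k 0 * G k (ybar, xbar) = 0.
    apply/le_anti; rewrite sumr_le0 //=.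
    by have := saddle _ Ybar; rewrite /L dotcv0 addr0 lerDl.
  rewrite -oppr_eq0 -sumrN psumr_eq0 => [|k _]; last by rewrite oppr_ge0 le0.
  by move=> /allP /(_ i (mem_index_enum i)) /=; rewrite oppr_eq0 => /eqP.
pose H := F + \sum_i mubar i 0 *: G i.
have HE z : H z = F z + \sum_i mubar i 0 * G i z.
  by rewrite /H fctE fct_sumE.
have dF : differentiable F (ybar, xbar) by case: (f_diff (ybar, xbar)).
have dG i : differentiable (G i) (ybar, xbar) by case: (g_diff i (ybar, xbar)).
have [dH dHE] : differentiable H (ybar, xbar) /\ forall h, 'd H (ybar, xbar) h =
    'd F (ybar, xbar) h + \sum_i mubar i 0 * 'd (G i) (ybar, xbar) h.
  split=> [|h].
    by case: (sum_smul_diff _ F G (fun i => mubar i 0) (ybar, xbar) 0 dF dG).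
  by case: (sum_smul_diff _ F G (fun i => mubar i 0) (ybar, xbar) h dF dG).
have Hbar : H (ybar, xbar) = F (ybar, xbar).
  by rewrite HE big1 ?addr0 // => i _; exact: slack.
have first_order y : Y y ->
    - dotcv lambar (A *m (y - ybar)) <= 'd H (ybar, xbar) (y - ybar, 0).
  move=> Yy.
  (* along the segment from ybar to y the affine part of the Lagrangian grows
     linearly, so only H has to be differentiated *)
  have dNH : differentiable (- H) (ybar, xbar) by exact: differentiableN.
  have := diff_le_slope _ (- H) (ybar, xbar) (y - ybar, 0)
    (dotcv lambar (A *m (y - ybar))) dNH.
  rewrite diffN //= => slope; rewrite lerNl; apply: slope => t t0 t1.
  pose yt := t *: y + (1 - t) *: ybar.
  have ytE : yt = ybar + t *: (y - ybar).
    by rewrite /yt scalerBl scale1r scalerBr addrCA.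
  have -> : (ybar, xbar) + t *: (y - ybar, 0 : 'cV[R]_m) = (yt, xbar).
    by rewrite [LHS]surjective_pairing /= scaler0 addr0 ytE.
  have := saddle yt (convex_set_comb Y_convex _ _ _ Yy Ybar t0 t1).
  rewrite /L (_ : A *m yt + B *m xbar - b = t *: (A *m (y - ybar))); last first.
    rewrite -Abar ytE mulmxDr -scalemxAr.
    by rewrite (addrC (A *m ybar)) -[X in X - _]addrA addrK.
  rewrite dotcvZr !fctE Hbar HE; lra.
have gradient_ineq x y : X x -> Y y ->
    'd H (ybar, xbar) (y - ybar, x - xbar) <= H (y, x) - H (ybar, xbar).
  move=> Xx Yy; apply: diff_le_slope => // t t0 t1.
  have -> : (ybar, xbar) + t *: (y - ybar, x - xbar) =
      t *: (y, x) + (1 - t) *: (ybar, xbar).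
    rewrite [LHS]surjective_pairing [RHS]surjective_pairing /=.
    by rewrite !scalerBl !scale1r !scalerBr !(addrCA _ (t *: _)).
  have Fc := convex_efun_fine fN f_convex (ff _ _ Yy Xx) fbarF t0 t1.
  have Gc : \sum_i mubar i 0 * G i (t *: (y, x) + (1 - t) *: (ybar, xbar)) <=
      t * (\sum_i mubar i 0 * G i (y, x)) +
      (1 - t) * (\sum_i mubar i 0 * G i (ybar, xbar)).
    rewrite !mulr_sumr -big_split /=; apply: ler_sum => i _.
    have := convex_efun_fine (g_not_ninfty i) (g_convex i)
      (gf i _ _ Yy Xx) (gf i _ _ Ybar xbarX) t0 t1.
    by move=> /(ler_wpM2l (mu0 i)) /le_trans -> //; rewrite /G /=; lra.
  rewrite !HE; rewrite /F /= in Fc *; lra.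
(* By slackness the sum over the active constraints is the full sum. *)
have sE h : dotcv (gradx f ybar xbar + B^T *m lambar
     + \sum_(i < p | g i (ybar, xbar) == 0%E)
         mubar i 0 *: gradx (g i) ybar xbar) h =
    'd H (ybar, xbar) (0, h) + dotcv lambar (B *m h).
  rewrite !dotcvDl dotcv_suml dotcv_trmulmx dotcv_gradx // dHE addrAC.
  congr (_ + _ + _); rewrite big_mkcond /=; apply: eq_bigr => i _.
  rewrite dotcvZl dotcv_gradx; last exact: dG.
  case: ifPn => // gi0.
  have /eqP := slack i; rewrite mulf_eq0 => /orP[/eqP ->|]; first by rewrite mul0r.
  move=> /eqP Gi0; case/negP: gi0; rewrite -(fineK (gf i _ _ Ybar xbarX)).
  by apply/eqP; congr EFin.
move=> x Xx; rewrite sE; apply: le_ereal_inf_tmp => _ [y [Yy Ayx gyx] <-].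
rewrite -fbar -(fineK fbarF) -(fineK (ff y x Yy Xx)) lee_fin.
have split_dir : 'd H (ybar, xbar) (y - ybar, x - xbar) =
    'd H (ybar, xbar) (y - ybar, 0) + 'd H (ybar, xbar) (0, x - xbar).
  rewrite -linearD; congr ('d H _ _).
  by rewrite [RHS]surjective_pairing /= addr0 add0r.
have := gradient_ineq x y Xx Yy; rewrite split_dir Hbar HE.
have := first_order y Yy.
have -> : A *m (y - ybar) = - (B *m (x - xbar)).
  apply/eqP; rewrite -addr_eq0 !mulmxBr addrACA Ayx -opprD Abar; exact/eqP/subrr.
have Gx : \sum_i mubar i 0 * G i (y, x) <= 0.
  apply: sumr_le0 => i _; apply: mulr_ge0_le0 => //.
  by rewrite -lee_fin fineK ?gyx //; exact: gf.
rewrite -[- (B *m _)]scaleN1r dotcvZr /F /=; lra.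
Qed.
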